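(* For every finite generating set $X$ of the free inverse monoid $\mathrm{FIM}_1$ of rank $1$, the word problem $\mathrm{WP}(\mathrm{FIM}_1,X)$ is recognised by a checking stack automaton, and the two-tape word problem $\iota(\mathrm{FIM}_1,X)$ is recognised by a (two-tape) checking stack automaton.
   Context: A monoid $M$ is inverse if for every $x\in M$ there is a unique $y\in M$ (the inverse $x^{-1}$ of $x$) with $xyx=x$ and $yxy=y$. For a set $X$, let $X^{-1}=\{\overline{x}\mid x\in X\}$ be a disjoint set of formal inverses and $X^{\pm}=X\cup X^{-1}$; put $x^{-1}=\overline{x}$ and $\overline{x}^{-1}=x$ for $x\in X$, and for a word $w=w_1\cdots w_n$ with $w_i\in X^{\pm}$ put $w^{\mathrm{inv}}=w_n^{-1}\cdots w_1^{-1}$. The free inverse monoid $\mathrm{FIM}(X)$ is the free object on $X$ in the variety of inverse monoids, i.e. the quotient of $(X^{\pm})^*$ by the relations $u=uu^{\mathrm{inv}}u$ and $uu^{\mathrm{inv}}vv^{\mathrm{inv}}=vv^{\mathrm{inv}}uu^{\mathrm{inv}}$ for $u,v\in (X^{\pm})^*$. If $|X|=k$ it is denoted $\mathrm{FIM}_k$. If $M$ is an inverse monoid and $X\subseteq M$ is a finite set generating $M$ as an inverse monoid, words over $X^{\pm}$ are evaluated in $M$ by interpreting $\overline{x}$ as the inverse of $x$, and $u=_M v$ means that $u$ and $v$ represent the same element of $M$. With $\#$ a symbol not in $X^{\pm}$, $$\mathrm{WP}(M,X)=\{u\#v^{\mathrm{inv}}\mid u,v\in (X^{\pm})^*,\ u=_M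 v\},$$ $$\iota(M,X)=\{(u,v)\in (X^{\pm})^*\times (X^{\pm})^*\mid u=_M v\}.$$ A checking stack automaton is a nondeterministic one-way automaton with finitely many states, a finite stack alphabet, and a stack whose contents can be altered only before reading of the input begins. In the set-up phase, without consuming input, it nondeterministically writes (under finite-state control) a word on the stack and places the stack marker at some position. In the reading phase, depending on the current state, the next input symbol (or $\varepsilon$) and the stack symbol at the marker, it changes state and moves the marker one position up, one position down, or not at all, never altering the stack contents and never moving beyond either end of the stack. The input is followed by an end-marker $\$$, and the input is accepted if some computation reads all of it including $\$$ and ends in a final state. A two-tape checking stack automaton recognising a relation $R\subseteq A^*\times A^*$ is defined in the same way, except that it has two one-way input tapes, each ended by $\$$, and in each step of the reading phase may read from either tape (asynchronously). *)

(* Defs.v *)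
From HB Require Import structures.
From mathcomp Require Import all_boot.
From mathcomp Require Import finmap generic_quotient.
From mathcomp Require Import boolp classical_sets.

Set Implicit Arguments.
Unset Strict Implicit.
Unset Printing Implicit Defensive.

Local Open Scope group_scope.

(* [x^-1] is the unique [y] with [x y x = x] and [y x y = y]. The star-monoid
   axioms (inversion is an involutive antimorphism) hold in every inverse monoid;
   they are only there to inherit the library's structure. *)
HB.mixin Record isInverseMonoid M of StarMonoid M := {
  inverseP : forall x y : M,
    x * y * x = x /\ y * x * y = y <-> y = x^-1
}.

#[short(type="inverseMonoidType")]
HB.structure Definition InverseMonoid :=
  {M of isInverseMonoid M & StarMonoid M}.

Section Regular.
Variable M : starMonoidType.
Hypothesis reg : forall x : M, x * x^-1 * x = x.
Hypothesis comm : forall x y : M, x * x^-1 * (y * y^-1) = y * y^-1 * (x * x^-1).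

Let idemE (e : M) : e * e = e -> e = e * e^-1.
Proof.
move=> ee; have ss : e^-1 * e^-1 = e^-1 by rewrite -invgM ee.
have es : e^-1 = e.
  have regV : e^-1 * e * e^-1 = e^-1 by rewrite -{2}(invgK e) reg.
  have := comm e^-1 e; rewrite invgK !mulgA.
  by rewrite -(mulgA e^-1 e e) ee regV -(mulgA e e^-1 e^-1) ss reg.
by rewrite es ee.
Qed.

Let idemC (e f : M) : e * e = e -> f * f = f -> e * f = f * e.
Proof. by move=> /idemE -> /idemE ->; exact: comm. Qed.

Lemma regular_inverseP (x y : M) :
  x * y * x = x /\ y * x * y = y <-> y = x^-1.
Proof.
have regV : x^-1 * x * x^-1 = x^-1 by rewrite -{2}(invgK x) reg.
split=> [[xyx yxy]|->]; last by split.
have yE : y * x * x^-1 = y.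
  have xC : (x * x^-1) * (x * y) = (x * y) * (x * x^-1).
    by apply: idemC; rewrite mulgA ?reg ?xyx.
  transitivity (y * ((x * y) * (x * x^-1))); first by rewrite !mulgA yxy.
  by rewrite -xC !mulgA -(mulgA y) -(mulgA y) reg.
have sE : y * x * x^-1 = x^-1.
  have xC : (x^-1 * x) * (y * x) = (y * x) * (x^-1 * x).
    by apply: idemC; rewrite mulgA ?regV ?yxy.
  transitivity ((y * x) * (x^-1 * x) * x^-1).
    by rewrite -!mulgA (mulgA x^-1) regV.
  by rewrite -xC !mulgA -(mulgA x^-1 x) -(mulgA x^-1) xyx.
by rewrite -[LHS]yE.
Qed.
End Regular.

(* [(x, false)] is the letter [x] and [(x, true)] its formal inverse. *)
Notation signed T := (T * bool)%type.

Definition inv_letter (T : Type) (a : signed T) : signed T := (a.1, ~~ a.2).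

Definition inv_word (T : Type) (w : seq (signed T)) : seq (signed T) :=
  rev (map (@inv_letter T) w).

Inductive fim_cong (T : Type) : seq (signed T) -> seq (signed T) -> Prop :=
| FimRefl u : fim_cong u u
| FimSym u v : fim_cong u v -> fim_cong v u
| FimTrans u v w : fim_cong u v -> fim_cong v w -> fim_cong u w
| FimCat u u' v v' :
    fim_cong u u' -> fim_cong v v' -> fim_cong (u ++ v) (u' ++ v')
| FimReg u : fim_cong u (u ++ inv_word u ++ u)
| FimComm u v :
    fim_cong (u ++ inv_word u ++ v ++ inv_word v)
             (v ++ inv_word v ++ u ++ inv_word u).

Lemma inv_wordK (T : Type) : involutive (@inv_word T).
Proof.
move=> w; rewrite /inv_word map_rev revK -map_comp.
by rewrite -[RHS]map_id; apply: eq_map => -[x b]; rewrite /inv_letter /= negbK.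
Qed.

Lemma inv_word_cat (T : Type) (u v : seq (signed T)) :
  inv_word (u ++ v) = inv_word v ++ inv_word u.
Proof. by rewrite /inv_word map_cat rev_cat. Qed.

Lemma fim_cong_inv (T : Type) (u v : seq (signed T)) :
  fim_cong u v -> fim_cong (inv_word u) (inv_word v).
Proof.
elim=> {u v} [u|u v _ IH|u v w _ IHu _ IHw|u u' v v' _ IHu _ IHv|u|u v].
- exact: FimRefl.
- exact: FimSym.
- exact: FimTrans IHu IHw.
- by rewrite !inv_word_cat; apply: FimCat.
- by have := FimReg (inv_word u); rewrite !inv_word_cat inv_wordK catA.
- rewrite !inv_word_cat !inv_wordK -!catA; exact: FimComm.
Qed.

Section FreeInverseMonoid.
Variable T : choiceType.

Definition fim_rel : rel (seq (signed T)) := fun u v => `[< fim_cong u v >].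

Lemma fim_rel_refl : reflexive fim_rel.
Proof. by move=> u; apply/asboolP; exact: FimRefl. Qed.

Lemma fim_rel_sym : symmetric fim_rel.
Proof. by move=> u v; apply/asboolP/asboolP; exact: FimSym. Qed.

Lemma fim_rel_trans : transitive fim_rel.
Proof. by move=> v u w /asboolP uv /asboolP vw; apply/asboolP/(FimTrans uv). Qed.

Canonical fim_equiv := EquivRel fim_rel fim_rel_refl fim_rel_sym fim_rel_trans.

Definition FIM := {eq_quot fim_equiv}%qT.
HB.instance Definition _ := Choice.on FIM.

Definition fim_class (w : seq (signed T)) : FIM := (\pi_{eq_quot fim_equiv} w)%qT.

Lemma fim_classP u v : fim_class u = fim_class v <-> fim_cong u v.
Proof.
split=> [uv|uv]; first by apply/asboolP; apply/(@eqmodP _ fim_equiv).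
by apply/(@eqmodP _ fim_equiv)/asboolP.
Qed.

Lemma fim_classK (x : FIM) : fim_class (repr x) = x.
Proof. exact: reprK. Qed.

Definition fim_one : FIM := fim_class [::].
Definition fim_mul (x y : FIM) : FIM := fim_class (repr x ++ repr y).
Definition fim_inv (x : FIM) : FIM := fim_class (inv_word (repr x)).

Lemma fim_class_mul u v : fim_mul (fim_class u) (fim_class v) = fim_class (u ++ v).
Proof. by apply/fim_classP/FimCat; apply/fim_classP; rewrite fim_classK. Qed.

Lemma fim_class_inv u : fim_inv (fim_class u) = fim_class (inv_word u).
Proof. by apply/fim_classP/fim_cong_inv/fim_classP; rewrite fim_classK. Qed.

Lemma fim_mulA : associative fim_mul.
Proof.
move=> x y z; rewrite -(fim_classK x) -(fim_classK y) -(fim_classK z).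
by rewrite !fim_class_mul catA.
Qed.

Lemma fim_mul1 : left_id fim_one fim_mul.
Proof. by move=> x; rewrite -(fim_classK x) fim_class_mul. Qed.

Lemma fim_invK : involutive fim_inv.
Proof. by move=> x; rewrite -(fim_classK x) !fim_class_inv inv_wordK. Qed.

Lemma fim_invM : {morph fim_inv : x y / fim_mul x y >-> fim_mul y x}.
Proof.
move=> x y; rewrite -(fim_classK x) -(fim_classK y).
by rewrite !(fim_class_mul, fim_class_inv) inv_word_cat.
Qed.

HB.instance Definition _ :=
  isStarMonoid.Build FIM fim_mulA fim_mul1 fim_invK fim_invM.

Lemma fim_classM u v : fim_class u * fim_class v = fim_class (u ++ v).
Proof. exact: fim_class_mul. Qed.

Lemma fim_classV u : (fim_class u)^-1 = fim_class (inv_word u).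
Proof. exact: fim_class_inv. Qed.

Lemma fim_regular (x : FIM) : x * x^-1 * x = x.
Proof.
rewrite -(fim_classK x) !(fim_classM, fim_classV) -catA.
by apply/fim_classP/FimSym/FimReg.
Qed.

Lemma fim_comm (x y : FIM) :
  x * x^-1 * (y * y^-1) = y * y^-1 * (x * x^-1).
Proof.
rewrite -(fim_classK x) -(fim_classK y) !(fim_classM, fim_classV).
by rewrite -!catA; apply/fim_classP/FimComm.
Qed.

HB.instance Definition _ :=
  isInverseMonoid.Build FIM (regular_inverseP fim_regular fim_comm).

End FreeInverseMonoid.

Definition FIM_ (k : nat) : inverseMonoidType := FIM 'I_k.

Section WordProblems.
Variables (M : inverseMonoidType) (X : {fset M}).

Definition generates : Prop :=
  forall S : set M,
    S 1 -> (forall x y, S x -> S y -> S (x * y)) ->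
    (forall x, S x -> S x^-1) -> (forall x, x \in X -> S x) ->
    forall m, S m.

Definition eval_letter (a : signed X) : M :=
  if a.2 then (val a.1)^-1 else val a.1.

Definition eval_word (w : seq (signed X)) : M := \prod_(a <- w) eval_letter a.

(* The alphabet is [option (signed X)]: [None] is the separator [#]. *)
Definition word_problem : set (seq (option (signed X))) :=
  [set w | exists u v : seq (signed X),
    eval_word u = eval_word v /\
    w = map Some u ++ None :: map Some (inv_word v)]%classic.

Definition two_tape_word_problem : set (seq (signed X) * seq (signed X)) :=
  [set uv | eval_word uv.1 = eval_word uv.2]%classic.

End WordProblems.
Arguments word_problem {M} X _.
Arguments two_tape_word_problem {M} X _.

Inductive tape_symbol (A : Type) := Letter (a : A) | EndMarker.
Arguments EndMarker {A}.

Definition tape (A : Type) (w : seq A) : seq (tape_symbol A) :=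
  rcons (map (@Letter A) w) EndMarker.

Inductive move := Up | Down | Stay.

Definition moves (d : move) (i j : nat) : Prop :=
  match d with Up => j = i.+1 | Down => i = j.+1 | Stay => j = i end.

(* [L] is the type of input labels of reading steps; a step labelled [None]
   reads nothing. [csa_write p g q]: in state [p], the set-up phase may push [g]
   on the stack and enter [q]. *)
Record csa (L : Type) := CSA {
  csa_state : finType;
  csa_stack : finType;
  csa_init : csa_state;
  csa_final : pred csa_state;
  csa_write : csa_state -> csa_stack -> csa_state -> bool;
  csa_read :
    csa_state -> option L -> csa_stack -> csa_state -> move -> bool
}.

Section Runs.
Variables (L : Type) (C : csa L).
Variables (input : Type) (consume : option L -> input -> input -> Prop).

(* Stack contents are listed from bottom to top. *)
Inductive csa_setup : seq (csa_stack C) -> csa_state C -> Prop :=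
| SetupNil : csa_setup [::] (csa_init C)
| SetupWrite s p g q :
    csa_setup s p -> csa_write p g q -> csa_setup (rcons s g) q.

(* [csa_run s p w i q w' j]: with stack contents [s], the automaton can go from
   state [p], remaining input [w] and marker position [i] to state [q],
   remaining input [w'] and marker position [j]. *)
Inductive csa_run (s : seq (csa_stack C)) :
    csa_state C -> input -> nat -> csa_state C -> input -> nat -> Prop :=
| RunRefl p w i : csa_run s p w i p w i
| RunStep p l g q d w w' i j r w'' k :
    onth s i = Some g -> csa_read p l g q d -> consume l w w' ->
    moves d i j -> (j < size s)%N ->
    csa_run s q w' j r w'' k ->
    csa_run s p w i r w'' k.

(* The set-up phase may leave the marker on any cell [i] of the stack, and the
   reading phase starts in the state [p] reached by the set-up. *)
Definition csa_accepts (w w_end : input) : Prop :=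
  exists s p i q j,
    [/\ csa_setup s p, (i < size s)%N, csa_run s p w i q w_end j
      & csa_final q].

End Runs.

Inductive consume1 (A : Type) :
    option (tape_symbol A) -> seq (tape_symbol A) -> seq (tape_symbol A) -> Prop :=
| Consume1Eps w : consume1 None w w
| Consume1Read a w : consume1 (Some a) (a :: w) w.

(* [inl a] reads [a] from the first tape, [inr a] from the second. *)
Inductive consume2 (A : Type) :
    option (tape_symbol A + tape_symbol A) ->
    seq (tape_symbol A) * seq (tape_symbol A) ->
    seq (tape_symbol A) * seq (tape_symbol A) -> Prop :=
| Consume2Eps w : consume2 None w w
| Consume2Fst a w1 w2 : consume2 (Some (inl a)) (a :: w1, w2) (w1, w2)
| Consume2Snd a w1 w2 : consume2 (Some (inr a)) (w1, a :: w2) (w1, w2).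

Definition csa_recognised (A : finType) (K : set (seq A)) : Prop :=
  exists C : csa (tape_symbol A),
    forall w, K w <-> csa_accepts C (@consume1 A) (tape w) [::].

Definition csa2_recognised (A : finType) (K : set (seq A * seq A)) : Prop :=
  exists C : csa (tape_symbol A + tape_symbol A),
    forall u v,
      K (u, v) <-> csa_accepts C (@consume2 A) (tape u, tape v) ([::], [::]).

(* Main.v *)
(* A word over the free generator of FIM_1 and its inverse is a walk on the
   integers, and by Munn's theorem two words are equal in FIM_1 iff their walks
   have the same endpoint and the same range. The automaton guesses this common
   data: its stack is the range, a block of cells 0, ..., n with both ends, the
   origin and the endpoint marked. Reading u, it moves the marker along the walk
   of u, expanding each generator into its spelling over the free generator; it
   checks that the walk never leaves the stack, meets both of its ends, and leads
   from the origin to the endpoint. The second word is then checked against the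
   same stack: backwards from the endpoint for v^inv on one tape, from the origin
   again for v on a second tape. *)
From HB Require Import structures.
Require Import Defs.
From mathcomp Require Import all_boot finmap.
From mathcomp Require Import ssralg ssrnum ssrint zify.

Set Implicit Arguments.
Unset Strict Implicit.
Unset Printing Implicit Defensive.

Local Open Scope group_scope.

Notation letter := (signed 'I_1).

(** * Munn's theorem in rank one *)

Definition shift (i : int) (a : letter) : int := (i + (if a.2 then -1 else 1))%R.

Definition endpoint (i : int) (w : seq letter) : int := foldl shift i w.

Definition visited (i : int) (w : seq letter) : seq int := i :: scanl shift i w.

Lemma endpoint_cat i u v : endpoint i (u ++ v) = endpoint (endpoint i u) v.
Proof. exact: foldl_cat. Qed.

Lemma last_visited i w : last i (scanl shift i w) = endpoint i w.
Proof. by elim: w i => //= a w IH i; rewrite IH. Qed.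

(** Only the sets agree: the junction point is listed twice on the right. *)
Lemma visited_cat i u v :
  visited i (u ++ v) =i visited i u ++ visited (endpoint i u) v.
Proof.
have mem_end : endpoint i u \in visited i u by rewrite -last_visited mem_last.
move=> z; rewrite {1}/visited scanl_cat -cat_cons !mem_cat.
rewrite [z \in visited (endpoint i u) v]in_cons.
by case: eqP => // ->; rewrite mem_end.
Qed.

Lemma shiftK i a : shift (shift i a) (inv_letter a) = i.
Proof. by rewrite /shift; case: a => [? []] /=; lia. Qed.

Lemma inv_word_cons T (a : signed T) w :
  inv_word (a :: w) = rcons (inv_word w) (inv_letter a).
Proof. by rewrite /inv_word map_cons rev_cons. Qed.

Lemma endpoint_inv i w : endpoint (endpoint i w) (inv_word w) = i.
Proof.
elim: w i => //= a w IH i; rewrite inv_word_cons -cats1 endpoint_cat.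
by rewrite IH /= shiftK.
Qed.

Lemma visited_inv i w : visited (endpoint i w) (inv_word w) =i visited i w.
Proof.
elim: w i => //= a w IH i z; rewrite inv_word_cons -cats1 visited_cat mem_cat.
rewrite IH endpoint_inv /visited /= shiftK !inE orbA orbC.
by case: (z == i); case: (z == shift i a); rewrite ?orbT ?orbF.
Qed.

(** The easy half of Munn's theorem: a word followed by its inverse is a loop with the range of the
    word, so both relations preserve endpoint and range. All starting points [i] are needed, as the
    second factor of a product starts where the first ends. *)
Lemma fim_cong_walk u v : fim_cong u v ->
  forall i, endpoint i u = endpoint i v /\ visited i u =i visited i v.
Proof.
elim=> {u v} [u|u v _ IH|u v w _ IHu _ IHw|u u' v v' _ IHu _ IHv|u|u v] i.
- by [].
- by have [-> uv] := IH i; split=> // z; rewrite uv.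
- by have [-> uv] := IHu i; have [-> vw] := IHw i; split=> // z; rewrite uv vw.
- have [eu vu] := IHu i; have [ev vv] := IHv (endpoint i u').
  rewrite !endpoint_cat eu ev; split=> // z.
  by rewrite !visited_cat !mem_cat vu eu vv.
- rewrite !endpoint_cat endpoint_inv; split=> // z.
  by rewrite !(visited_cat, mem_cat) endpoint_inv visited_inv !orbb.
- rewrite !(endpoint_cat, endpoint_inv); split=> // z.
  rewrite !(visited_cat, mem_cat, endpoint_cat, endpoint_inv, visited_inv).
  by do 2!case: (z \in _).
Qed.

(** * Normal forms *)

Definition up : letter := (ord0, false).
Definition down : letter := (ord0, true).

(** Down to the minimum, up to the maximum, down to the endpoint: for [a, k <= n] the range has
    length [n] and begins [a] below the origin. *)
Definition normal_word a n k := nseq a down ++ nseq n up ++ nseq k down.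

Lemma fim_class_cat (T : choiceType) (u v : seq (signed T)) :
  fim_class (u ++ v) = fim_class u * fim_class v :> FIM T.
Proof. by rewrite -fim_classM. Qed.

Lemma fim_class_nseq (T : choiceType) n (a : signed T) :
  fim_class (nseq n a) = (fim_class [:: a] : FIM T) ^+ n.
Proof. by elim: n => // n IH; rewrite expgS -IH -fim_class_cat. Qed.

Lemma fim_class_normal a n k :
  let x : FIM_ 1 := fim_class [:: up] in
  fim_class (normal_word a n k) = x ^- a * x ^+ n * x ^- k.
Proof.
by rewrite /= !fim_class_cat !fim_class_nseq -!expVgn fim_classV mulgA.
Qed.


Section NormalForm.
Variables (T : choiceType) (x : FIM T).

Let idemC n : x^-1 * x * (x ^+ n * x ^- n) = x ^+ n * x ^- n * (x^-1 * x).
Proof. by have := fim_comm x^-1 (x ^+ n); rewrite invgK. Qed.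

(** The new letter raises the maximum if the endpoint is there ([k = 0]); otherwise it only moves
    the endpoint up. *)
Lemma normal_mul_letter a n k : a <= n -> k <= n ->
  exists a' n' k', [/\ a' <= n', k' <= n' &
    x ^- a * x ^+ n * x ^- k * x = x ^- a' * x ^+ n' * x ^- k'].
Proof.
case: k => [|k] le_an le_kn.
  exists a, n.+1, 0; split=> //; first exact: leqW.
  by rewrite invg1 !mulg1 expgSr !mulgA.
exists a, n, k; split=> //; first exact: ltnW.
(* This isolates [x ^+ k * x ^- k]; the idempotent [x^-1 * x] commutes with it and is absorbed by
   the [x] in front. *)
have -> : n = n - k.+1 + 1 + k by lia.
rewrite !expgnDr expg1 expgS invgM -!mulgA; do 2!congr (_ * _).
by rewrite (mulgA (x ^+ k)) -idemC !mulgA fim_regular.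
Qed.

(** The endpoint moves down inside the range if [k < n]; if [k = n] it is the minimum, and the range
    grows by one below. *)
Lemma normal_mul_inv a n k : a <= n -> k <= n ->
  exists a' n' k', [/\ a' <= n', k' <= n' &
    x ^- a * x ^+ n * x ^- k * x^-1 = x ^- a' * x ^+ n' * x ^- k'].
Proof.
move=> le_an; rewrite leq_eqVlt => /predU1P[-> | lt_kn]; last first.
  by exists a, n, k.+1; split=> //; rewrite expgS invgM mulgA.
exists a.+1, n.+1, n.+1; split=> //.
rewrite !expgS !invgM -!mulgA; congr (_ * _).
transitivity (x ^+ n * x ^- n * (x^-1 * x) * x^-1); last first.
  by rewrite -idemC !mulgA.
by have := fim_regular x^-1; rewrite invgK -!mulgA => ->.
Qed.

End NormalForm.

Lemma letterE (a : letter) : a = if a.2 then down else up.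
Proof. by case: a => i [] /=; rewrite (ord1 i). Qed.

Lemma fim_normal (w : seq letter) :
  exists a n k, [/\ a <= n, k <= n & fim_cong w (normal_word a n k)].
Proof.
suff [a [n [k [le_an le_kn wE]]]] : exists a n k, [/\ a <= n, k <= n &
    fim_class w = fim_class (normal_word a n k)].
  by exists a, n, k; split=> //; apply/fim_classP.
elim/last_ind: w => [|w c [a [n [k [le_an le_kn wE]]]]]; first by exists 0, 0, 0.
pose x : FIM_ 1 := fim_class [:: up].
have [a' [n' [k' [le_an' le_kn' cE]]]] : exists a' n' k',
    [/\ a' <= n', k' <= n' & x ^- a * x ^+ n * x ^- k * fim_class [:: c]
                              = x ^- a' * x ^+ n' * x ^- k'].
  rewrite (letterE c); case: c.2; last exact: normal_mul_letter.
  have <- : x^-1 = fim_class [:: down] by rewrite fim_classV.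
  exact: normal_mul_inv.
exists a', n', k'; split=> //.
by rewrite -cats1 fim_class_cat wE !fim_class_normal.
Qed.

Lemma endpoint_nseq i n a :
  endpoint i (nseq n a) = (if a.2 then i - n%:Z else i + n%:Z)%R.
Proof. by elim: n i => [|n IH] i; rewrite /= ?IH /shift; case: a.2; lia. Qed.

Lemma visited_nseq i n a z : (z \in visited i (nseq n a)) =
  (if a.2 then i - n%:Z <= z <= i else i <= z <= i + n%:Z)%R.
Proof.
elim: n i => [|n IH] i; first by rewrite inE /=; case: a.2; lia.
by rewrite in_cons [X in _ || X]IH /shift; case: a.2; lia.
Qed.

Lemma endpoint_normal i a n k :
  endpoint i (normal_word a n k) = (i - a%:Z + n%:Z - k%:Z)%R.
Proof. by rewrite !endpoint_cat !endpoint_nseq. Qed.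

Lemma visited_normal i a n k z : a <= n -> k <= n ->
  (z \in visited i (normal_word a n k)) = (i - a%:Z <= z <= i - a%:Z + n%:Z)%R.
Proof.
move=> le_an le_kn; rewrite !(visited_cat, mem_cat, visited_nseq).
by rewrite !endpoint_nseq /=; lia.
Qed.

(* The last three conditions say that the range of the walk is [0, n]. *)
Definition walks (n i : nat) (w : seq letter) (j : nat) : Prop :=
  [/\ endpoint i w = j,
      forall z, z \in visited i w -> (0 <= z <= n%:Z)%R,
      0%R \in visited i w & n%:Z%R \in visited i w].

Lemma walks_inv n i w j : walks n i w j <-> walks n j (inv_word w) i.
Proof.
suff imp i' w' j' : walks n i' w' j' -> walks n j' (inv_word w') i'.
  by split=> [|/imp]; [exact: imp | rewrite inv_wordK].
case=> ej bnd v0 vn; split; rewrite -ej ?endpoint_inv ?visited_inv // => z.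
by rewrite visited_inv; apply: bnd.
Qed.

Lemma walks_cong n i u v j : fim_cong u v -> walks n i u j -> walks n i v j.
Proof.
case/fim_cong_walk/(_ i)=> eE vE [eu bnd v0 vn].
by split; rewrite -?eE -?vE // => z; rewrite -vE; apply: bnd.
Qed.

(** The hard half of Munn's theorem: start, endpoint and range determine all three parameters of a
    normal form. *)
Lemma walks_normal n i w j : walks n i w j -> fim_cong w (normal_word i n (n - j)).
Proof.
have [a [m [k [le_am le_km wE]]]] := fim_normal w.
case/(walks_cong wE); rewrite endpoint_normal !visited_normal // => ej bnd v0 vn.
(* The extremes of the normal form lie in [[0, n]], and 0 and [n] lie in its range, so the two
   intervals coincide. *)
have /bnd lo : (i%:Z - a%:Z)%R \in visited i (normal_word a m k).
  by rewrite visited_normal //; lia.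
have /bnd hi : (i%:Z - a%:Z + m%:Z)%R \in visited i (normal_word a m k).
  by rewrite visited_normal //; lia.
have [iE nE] : i = a /\ n = m by lia.
by rewrite iE nE (_ : m - j = k) //; lia.
Qed.

Lemma fim_cong_walksP u v :
  fim_cong u v <-> exists n i j, walks n i u j /\ walks n i v j.
Proof.
split=> [uv | [n [i [j [/walks_normal un /walks_normal vn]]]]]; last first.
  exact: FimTrans un (FimSym vn).
have [a [n [k [le_an le_kn uE]]]] := fim_normal u.
(* Starting at height [a] puts the minimum of the normal form at 0. *)
have nW : walks n a (normal_word a n k) (n - k).
  split=> [|z||]; rewrite ?endpoint_normal ?visited_normal //; lia.
by exists n, a, (n - k); split; apply: walks_cong nW; [| apply: FimTrans uv];
  apply: FimSym.
Qed.

(** * The automaton *)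

(* [lo] and [hi] record whether the walk has already met [0] and [n]. *)
Fixpoint fits (n : nat) (lo hi : bool) (i : nat) (w : seq letter) (j : nat) :=
  let lo' := lo || (i == 0) in
  let hi' := hi || (i == n) in
  (i <= n) &&
  if w is a :: w' then
    if a.2 then (0 < i) && fits n lo' hi' i.-1 w' j else fits n lo' hi' i.+1 w' j
  else [&& lo', hi' & i == j].

Lemma fitsP n lo hi i w j : fits n lo hi i w j <->
  [/\ endpoint i w = j,
      forall z, z \in visited i w -> (0 <= z <= n%:Z)%R,
      lo || (0%R \in visited i w) & hi || (n%:Z%R \in visited i w)].
Proof.
have i0 (k : nat) : (0%R == k%:Z)%R = (k == 0) by lia.
have iN (k : nat) : (n%:Z == k%:Z)%R = (k == n) by lia.
elim: w lo hi i => [|a w IH] lo hi i.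
  rewrite /= !inE i0 iN; split=> [/and4P[le_in -> -> /eqP<-] | [[<-] bnd -> ->]].
    by split=> // z; rewrite inE => /eqP->; lia.
  by have := bnd i; rewrite inE eqxx => /(_ isT); rewrite eqxx; lia.
have stepE (k : nat) : shift i a = k ->
    (i <= n) && fits n (lo || (i == 0)) (hi || (i == n)) k w j <->
    [/\ endpoint i (a :: w) = j,
        forall z, z \in visited i (a :: w) -> (0 <= z <= n%:Z)%R,
        lo || (0%R \in visited i (a :: w)) & hi || (n%:Z%R \in visited i (a :: w))].
  rewrite /visited /= => kE; rewrite kE -/(endpoint k w) -/(visited k w).
  rewrite !(in_cons i%:Z%R) i0 iN (orbA lo) (orbA hi); split.
    case/andP=> le_in /IH[ej bnd Hlo Hhi]; split=> // z.
    by rewrite in_cons => /predU1P[->|/bnd //]; lia.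
  case=> ej bnd Hlo Hhi; apply/andP; split.
    by have := bnd i; rewrite mem_head => /(_ isT); lia.
  by apply/IH; split=> // z zw; apply: bnd; rewrite in_cons zw orbT.
rewrite /=; case aE: a.2; last by apply: stepE; rewrite /shift aE; lia.
case: i stepE => [|i] stepE; last by apply: stepE; rewrite /shift aE; lia.
(* A step down from 0 would visit -1, so both sides fail. *)
rewrite andbF; split=> // -[_ bnd _ _].
have := bnd (-1)%R; rewrite /visited /= /shift aE !in_cons eqxx orbT.
by move/(_ isT).
Qed.

Lemma fits_walks n i w j : fits n false false i w j <-> walks n i w j.
Proof. exact: fitsP. Qed.

(** [fits] counts the current cell first, so counting it beforehand changes nothing. The machine
    does so whenever it reads a letter without moving. *)
Lemma fits_touched n lo hi i w j :
  fits n (lo || (i == 0)) (hi || (i == n)) i w j = fits n lo hi i w j.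
Proof. by case: w => [|a w] /=; rewrite -!orbA !orbb. Qed.

Lemma onth_mkseq T (f : nat -> T) n i :
  onth (mkseq f n) i = if i < n then Some (f i) else None.
Proof.
rewrite onthE; case: ltnP => [lt_in|le_ni]; last first.
  by rewrite nth_default // size_map size_mkseq.
by rewrite (nth_map (f 0)) ?size_mkseq // nth_mkseq.
Qed.

Lemma csa_run_trans L (C : csa L) input (consume : option L -> input -> input -> Prop)
    s p w i q w' j r w'' k :
  csa_run (C := C) consume s p w i q w' j -> csa_run consume s q w' j r w'' k ->
  csa_run consume s p w i r w'' k.
Proof.
elim=> {p w i q w' j} // p l g q d w1 w2 i j r' w3 k' sg pq l12 dij js _ IH rk.
exact: RunStep sg pq l12 dij js (IH rk).
Qed.

(* The four components say whether a cell is the bottom of the stack, the top,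
   the origin and the target of the first walk. *)
Definition mark := (bool * bool * bool * bool)%type.

Definition at_bottom (g : mark) := g.1.1.1.
Definition at_top (g : mark) := g.1.1.2.
Definition at_site (b : bool) (g : mark) := if b then g.2 else g.1.2.

Definition cell (n o e i : nat) : mark := (i == 0, i == n, i == o, i == e).

(** The marks occurring among the cells below [m]: all that the set-up has to remember. *)
Definition seen (n o e m : nat) : mark := (0 < m, n < m, o < m, e < m).

(** This keeps each mark from being written twice; that all four occur is tested when reading
    starts. *)
Definition write_mark (p g q : mark) : bool :=
  let: (b, t, o, e) := p in
  let: (b', t', o', e') := g in
  [&& ~~ t, b' == ~~ b, ~~ (o && o'), ~~ (e && e')
    & q == (true, t', o || o', e || e')].

Lemma write_cell n o e m : m <= n ->
  write_mark (seen n o e m) (cell n o e m) (seen n o e m.+1).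
Proof.
have seenS k : (k < m.+1) = (k < m) || (m == k).
  by rewrite ltnS leq_eqVlt orbC eq_sym.
move=> le_mn; rewrite /write_mark /seen /cell !seenS -leqNgt le_mn.
rewrite (ltnNge n) le_mn lt0n negbK eqxx orNb /=.
by do 2!case: ltngtP => _ //=.
Qed.

Lemma write_mark_inv n o e m g q :
  write_mark (seen n o e m) g q -> exists n' o' e',
    [/\ m <= n', g = cell n' o' e' m, q = seen n' o' e' m.+1
      & forall i, i < m -> cell n o e i = cell n' o' e' i].
Proof.
(* A mark already met keeps its cell, one written now gets cell [m], and one still pending is
   postponed to [m.+1]. *)
have update k (b : bool) : ~~ ((k < m) && b) -> exists k',
    [/\ ~~ (k < m) -> m <= k', b = (m == k'), (k < m) || b = (k' < m.+1)
      & forall i, i < m -> (i == k) = (i == k')].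
  case: ltnP b => [lt_km | le_mk] [] //= _; first by exists k; split=> //; lia.
    by exists m; split=> // [||i lt_im]; lia.
  by exists m.+1; split=> [|||i lt_im]; lia.
case: g => [[[b' t'] o'] e'] /and5P[ntop /eqP-> no ne /eqP->].
have [|n' [/(_ ntop) le_mn' -> tE nE]] := update n t'.
  by rewrite negb_and ntop.
have [o1 [_ -> -> oE]] := update o o' no.
have [e1 [_ -> -> eE]] := update e e' ne.
exists n', o1, e1; rewrite /cell /seen -tE (negbTE ntop) eqn0Ngt; split=> //.
by move=> i lt_im; rewrite nE ?oE ?eE.
Qed.

(** * One machine for both kinds of input *)

Section Machine.

Variables (L A : Type) (spell : A -> seq letter) (bound : nat).
Hypothesis spell_bound : forall a, size (spell a) <= bound.
(* [dec ph l] interprets the label [l] in phase [ph]: [Some (Some a)] is the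
   letter [a], [Some None] ends the phase, [None] is an error. If [back], the
   second walk leads from the target to the origin. *)
Variables (dec : bool -> L -> option (option A)) (back : bool).

(** The start of phase [ph], with [false] for the origin and [true] for the target; the phase ends
    at the other one. *)
Definition site (ph : bool) := ph && back.

(* In [Walk ph lo hi u], the word [u] remains to be walked before the next letter
   is read, and [lo], [hi] do not yet take the current cell into account: its
   symbol is only seen in the step leaving it. *)
Inductive control :=
| Setup of mark
| Seek of bool
| Walk of bool & bool & bool & bound.-bseq letter
| Accept.

Definition control_code (p : control) :
    mark + bool + option (bool * bool * bool * bound.-bseq letter) :=
  match p with
  | Setup f => inl (inl f)
  | Seek ph => inl (inr ph)
  | Walk ph lo hi u => inr (Some (ph, lo, hi, u))
  | Accept => inr None
  end.

Definition control_decode c :=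
  match c with
  | inl (inl f) => Setup f
  | inl (inr ph) => Seek ph
  | inr (Some (ph, lo, hi, u)) => Walk ph lo hi u
  | inr None => Accept
  end.

Lemma control_codeK : cancel control_code control_decode.
Proof. by case. Qed.

HB.instance Definition _ := Finite.copy control (can_type control_codeK).

(** A word longer than [bound] would become empty; spellings and their tails never are. *)
Definition walk ph lo hi u := Walk ph lo hi (insub_bseq bound u).

Definition next ph := if ph then Accept else Seek true.

Definition stays d := if d is Stay then true else false.

Definition follows (a : letter) d :=
  match d with Up => ~~ a.2 | Down => a.2 | Stay => false end.

Definition machine_write (p : control) (g : mark) (q : control) : bool :=
  match p, q with
  | Setup f, Setup f' => write_mark f g f'
  | _, _ => false
  end.

(** [Seek] wanders freely, since a phase may begin with the marker on any cell. Leaving the range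
    needs no test: a move off the stack is impossible. *)
Definition machine_read (p : control) (l : option L) (g : mark) (q : control)
    (d : move) : bool :=
  match p, l with
  | Setup f, None =>
      [&& stays d, f == (true, true, true, true) & q == Seek false]
  | Seek ph, None =>
      (q == Seek ph) ||
      [&& stays d, at_site (site ph) g & q == walk ph false false [::]]
  | Walk ph lo hi u, _ =>
      let lo' := lo || at_bottom g in
      let hi' := hi || at_top g in
      match bseqval u, l with
      | a :: u', None =>
          (q == walk ph lo' hi' u') && follows a d
      | [::], Some l =>
          match dec ph l with
          | Some (Some x) => stays d && (q == walk ph lo' hi' (spell x))
          | Some None =>
              [&& stays d, lo', hi', at_site (~~ site ph) g & q == next ph]
          | None => false
          end
      | _, _ => false
      end
  | _, _ => false
  end.

Definition machine : csa L :=
  @CSA L control mark (Setup (false, false, false, false))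
    (pred1 Accept) machine_write machine_read.

Variables (input : Type) (consume : option L -> input -> input -> Prop).
Hypothesis consumeE : forall w w', consume None w w' <-> w' = w.

Inductive reads (ph : bool) : input -> seq A -> input -> Prop :=
| ReadsEnd l w w' : dec ph l = Some None -> consume (Some l) w w' -> reads ph w [::] w'
| ReadsLetter l a w w' us w'' :
    dec ph l = Some (Some a) -> consume (Some l) w w' -> reads ph w' us w'' ->
    reads ph w (a :: us) w''.

(** The parameters of unwritten marks are still free and can be revised at each write, so the stack
    is always an initial segment of a correctly marked one. *)
Lemma setup_cells s p : csa_setup (C := machine) s p -> exists n o e,
  [/\ s = mkseq (cell n o e) (size s), p = Setup (seen n o e (size s))
    & size s <= n.+1].
Proof.
elim=> {s p} [|s p g q _ [n [o [e [sE -> le_sn]]]]]; first by exists 0, 0, 0.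
case: q => // f /write_mark_inv[n' [o' [e' [le_sn' -> -> cellE]]]].
exists n', o', e'; rewrite size_rcons; split=> //.
rewrite mkseqS {1}sE; congr rcons.
by apply/eq_in_map => i; rewrite mem_iota => /cellE.
Qed.

Lemma cells_setup n o e : o <= n -> e <= n ->
  csa_setup (C := machine) (mkseq (cell n o e) n.+1) (Setup (true, true, true, true)).
Proof.
move=> le_on le_en.
have -> : Setup (true, true, true, true) = Setup (seen n o e n.+1).
  by rewrite /seen !ltnS le_on le_en leqnn.
elim: {-2}n.+1 (leqnn n.+1) => [_ | m IH lt_mn]; first exact: SetupNil.
by rewrite mkseqS; apply: SetupWrite (IH (ltnW lt_mn)) _; apply: write_cell.
Qed.

(** * Runs on a fixed stack *)

Section FixedStack.
Variables n o e : nat.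
Let s := mkseq (cell n o e) n.+1.
Let pos (b : bool) := if b then e else o.

Let at_siteE b i : at_site b (cell n o e i) = (i == pos b).
Proof. by case: b. Qed.

(** The condition [cont] on the remaining input lets the second phase be nested in the first. *)
Definition phase_ok (cont : input -> Prop) ph w lo hi i u := exists us w1,
  [/\ reads ph w us w1,
      fits n lo hi i (u ++ flatten (map spell us)) (pos (~~ site ph)) & cont w1].

Definition after w_end ph w :=
  if ph then w = w_end
  else phase_ok (fun w1 => w1 = w_end) true w false false (pos (site true)) [::].

(** The soundness invariant, carried backwards along a run that ends in [Accept]. At [Seek] the
    position is ignored, as the marker has yet to find its site. *)
Definition accepting w_end (p : control) w i : Prop :=
  match p with
  | Setup f => f = (true, true, true, true) /\
      phase_ok (after w_end false) false w false false (pos (site false)) [::]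
  | Seek ph => phase_ok (after w_end ph) ph w false false (pos (site ph)) [::]
  | Walk ph lo hi u => phase_ok (after w_end ph) ph w lo hi i u
  | Accept => w = w_end
  end.

Lemma run_accepting p w i q w_end j :
  csa_run (C := machine) consume s p w i q w_end j -> q = Accept ->
  accepting w_end p w i.
Proof.
elim=> {p w i q w_end j} [p w i -> // |p l g q d w w' i j r w_end k].
rewrite onth_mkseq; case: ltnP => // lt_in [<-] pq ww' dij _ _ acc rA.
have {acc} := acc rA.
case: p pq => [f|ph|ph lo hi u|] /=; last by [].
- case: l ww' => // /consumeE-> /and3P[_ /eqP-> /eqP->].
  by rewrite /=; split.
- case: l ww' => // /consumeE-> /orP[/eqP-> // | ].
  case/and3P; rewrite at_siteE; case: d dij => //= -> _ /eqP-> /eqP->.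
  by rewrite /= insubdK.
- rewrite /at_bottom /at_top /=.
  case uE: (bseqval u) (size_bseq u) => [|a u'] /= le_u; case: l ww' => //=.
  + move=> l ww'; case lE: (dec ph l) => [[x|]|] //.
      case: d dij => //= -> /eqP-> [us [w1 [rd]]].
      (* The flags already include cell [i], where the spelling starts. *)
      rewrite insubdK ?fits_touched -?topredE //= => ft ct.
      by exists (x :: us), w1; split=> //; apply: ReadsLetter lE ww' rd.
    case: d dij => //= -> /and4P[lo' hi']; rewrite at_siteE => iE /eqP-> acc.
    exists [::], w'; split; first exact: ReadsEnd lE ww'.
      by rewrite /= lo' hi' iE -ltnS lt_in.
    by case: ph acc {lE iE}.
  + move=> /consumeE-> /andP[/eqP->]; rewrite /= insubdK; last exact: ltnW.
    move=> da [us [w1 [rd ft ct]]]; exists us, w1; split=> //=.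
    rewrite -ltnS lt_in /=.
    case: d da dij => //= [/negbTE-> <- // | -> iE].
    by move: ft; rewrite iE.
Qed.

Lemma run_step p l q d w w' i j r w'' k :
  i <= n -> machine_read p l (cell n o e i) q d -> consume l w w' ->
  moves d i j -> j <= n -> csa_run (C := machine) consume s q w' j r w'' k ->
  csa_run (C := machine) consume s p w i r w'' k.
Proof.
move=> le_in pq ww' dij le_jn.
have si : onth s i = Some (cell n o e i) by rewrite onth_mkseq ltnS le_in.
have js : j < size s by rewrite size_mkseq.
exact: (RunStep (C := machine) si pq ww' dij js).
Qed.

(** Going down to cell 0 and up again avoids comparing [i] with [j]. *)
Lemma run_seek ph w i j : i <= n -> j <= n ->
  csa_run (C := machine) consume s (Seek ph) w i (Seek ph) w j.
Proof.
have step k k' d : moves d k k' -> k <= n -> k' <= n ->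
    csa_run (C := machine) consume s (Seek ph) w k (Seek ph) w k'.
  move=> dk le_kn le_kn'.
  apply: (run_step (l := None) le_kn _ _ dk le_kn'); last exact: RunRefl.
    by rewrite /= eqxx.
  exact/consumeE.
move=> le_in le_jn.
have to0 : csa_run (C := machine) consume s (Seek ph) w i (Seek ph) w 0.
  elim: i le_in => [_|i IH lt_in]; first exact: RunRefl.
  by apply: csa_run_trans (IH (ltnW lt_in)); apply: (step _ _ Down) => //; lia.
apply: csa_run_trans to0 _.
elim: j le_jn => [_|j IH lt_jn]; first exact: RunRefl.
by apply: csa_run_trans (IH (ltnW lt_jn)) _; apply: (step _ _ Up) => //; lia.
Qed.

(** Walks the pending word to its end, where the next letter can be read. *)
Lemma run_pending ph w lo hi i u v j : size u <= bound -> fits n lo hi i (u ++ v) j ->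
  exists lo' hi' i', fits n lo' hi' i' v j /\
    csa_run (C := machine) consume s (walk ph lo hi u) w i (walk ph lo' hi' [::]) w i'.
Proof.
elim: u lo hi i => [|a u IH] lo hi i /= le_u.
  by exists lo, hi, i; split=> //; apply: RunRefl.
case/andP=> le_in ft.
have [k [d [dik da ft']]] : exists k d, [/\ moves d i k,
    follows a d
    & fits n (lo || (i == 0)) (hi || (i == n)) k (u ++ v) j].
  rewrite /follows; case: a.2 ft => [/andP[i_gt0]|] ft; last by exists i.+1, Up.
  by exists i.-1, Down; rewrite /= prednK.
have le_kn : k <= n by move: ft'; case: (u ++ v) => [|? ?] /andP[].
have [lo' [hi' [i' [ft'' run]]]] := IH _ _ _ (ltnW le_u) ft'.
exists lo', hi', i'; split=> //.
apply: (run_step (l := None) le_in _ _ dik le_kn run); last exact/consumeE.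
by rewrite /= insubdK //= /at_bottom /at_top eqxx da.
Qed.

Lemma run_walk ph w us w1 lo hi i u :
  reads ph w us w1 -> size u <= bound ->
  fits n lo hi i (u ++ flatten (map spell us)) (pos (~~ site ph)) ->
  csa_run (C := machine) consume s
    (walk ph lo hi u) w i (next ph) w1 (pos (~~ site ph)).
Proof.
move=> rd; elim: rd lo hi i u => {w us w1} [l w w1 lE ww1 | l a w w1 us w2 lE ww1 _ IH]
  lo hi i u le_u /(run_pending ph w le_u)[lo' [hi' [i' [ft run]]]];
  apply: csa_run_trans run _.
  have /and4P[le_in Hlo Hhi /eqP <-] := ft.
  apply: (run_step (d := Stay) le_in _ ww1 erefl le_in); last exact: RunRefl.
  rewrite /= insubdK //= lE /at_bottom /at_top /= Hlo Hhi eqxx at_siteE.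
  by have /and4P[_ _ _ ->] := ft.
have le_in : i' <= n by move: ft => /=; case: (_ ++ _) => [|? ?] /andP[].
apply: (run_step (d := Stay) (q := walk ph (lo' || (i' == 0)) (hi' || (i' == n))
  (spell a)) le_in _ ww1 erefl le_in).
  by rewrite /= insubdK //= lE eqxx.
by apply: IH => //; rewrite fits_touched.
Qed.

Lemma run_phase ph w us w1 i : o <= n -> e <= n -> i <= n -> reads ph w us w1 ->
  fits n false false (pos (site ph)) (flatten (map spell us)) (pos (~~ site ph)) ->
  csa_run (C := machine) consume s (Seek ph) w i (next ph) w1 (pos (~~ site ph)).
Proof.
move=> le_on le_en le_in rd ft.
have le_pn b : pos b <= n by case: b.
apply: csa_run_trans (run_seek ph w le_in (le_pn (site ph))) _.
apply: csa_run_trans (run_walk (u := [::]) rd (leq0n _) ft).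
apply: (run_step (l := None) (d := Stay) (le_pn _) _ _ erefl (le_pn _));
  last exact: RunRefl; last exact/consumeE.
by rewrite /= at_siteE !eqxx ?orbT.
Qed.

End FixedStack.

(** The first step out of [Setup] tests for all four marks. The top mark then gives the exact height
    of the stack, which the invariant presupposes. *)
Lemma run_setup_full s f w i w' j :
  csa_run (C := machine) consume s (Setup f) w i Accept w' j ->
  f = (true, true, true, true).
Proof.
move pE: (Setup f) => p; move qE: Accept => q run.
case: run pE qE => [? ? ? <- // | p' l g q' d ? ? ? ? ? ? ? _ + _ _ _ _ pE _].
by rewrite -pE; case: l => //= /and3P[_ /eqP].
Qed.

Lemma machineP w w_end :
  csa_accepts machine consume w w_end <-> exists n i j us vs w1,
    [/\ reads false w us w1, reads true w1 vs w_end,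
        walks n i (flatten (map spell us)) j
      & walks n i
          (if back then inv_word (flatten (map spell vs))
           else flatten (map spell vs)) j].
Proof.
split=> [[s [p [i [q [j [/setup_cells[n [o [e [sE -> le_sn]]]] _ run /eqP qE]]]]]] |].
  move: run; rewrite {}qE => run.
  have [_ lt_ns _ _] := run_setup_full run.
  have sizeE : size s = n.+1 by apply/eqP; rewrite eqn_leq le_sn.
  move: run; rewrite sE sizeE => /run_accepting/(_ erefl)[_].
  case=> us [w1 [rd1 /fits_walks wk1 [vs [w2 [rd2 /fits_walks wk2 w2E]]]]].
  exists n, o, e, us, vs, w1; rewrite w2E in rd2; split=> //.
  by move: wk2; rewrite /site /=; case: back => // /walks_inv.
case=> n [i [j [us [vs [w1 [rd1 rd2 wk1 wk2]]]]]].
(* Both are visited by the first walk, so the set-up can mark them. *)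
have [le_in le_jn] : i <= n /\ j <= n.
  have [ej bnd _ _] := wk1.
  have := bnd i; rewrite mem_head => /(_ isT).
  have := bnd j; rewrite -{1}ej -last_visited mem_last => /(_ isT).
  by lia.
exists (mkseq (cell n i j) n.+1), (Setup (true, true, true, true)), 0, Accept.
exists (if back then i else j); split; rewrite ?size_mkseq //.
- exact: cells_setup.
- apply: (@run_step n i j _ None (Seek false) Stay w w 0 0) => //.
    exact/consumeE.
  apply: csa_run_trans (run_phase le_in le_jn (leq0n _) rd1 _) _.
    exact/fits_walks.
  have -> : (if back then i else j) = if ~~ site true then j else i.
    by rewrite /site /=; case: back.
  apply: (run_phase le_in le_jn _ rd2); first by rewrite /site.
  apply/fits_walks; move: wk2; rewrite /site /=.
  by case: back => // wk2; apply/walks_inv.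
Qed.

End Machine.

(** * The word problems *)

Section Spelling.
Variable X : {fset FIM_ 1}.

Definition spell (a : signed X) : seq letter :=
  let r := repr (val a.1 : FIM 'I_1) in if a.2 then inv_word r else r.

Definition spell_word (w : seq (signed X)) : seq letter := flatten (map spell w).

Definition max_spell := \max_(a : signed X) size (spell a).

Lemma size_spell a : size (spell a) <= max_spell.
Proof. exact: leq_bigmax. Qed.

Lemma eval_wordE w : eval_word w = fim_class (spell_word w).
Proof.
elim: w => [|a w IH]; rewrite /eval_word ?big_nil // big_cons.
rewrite -/(eval_word w) IH /spell_word /= fim_class_cat; congr (_ * _).
rewrite /eval_letter /spell; case: a.2; last by rewrite fim_classK.
by rewrite -fim_classV fim_classK.
Qed.

Lemma eval_word_eq u v :
  eval_word u = eval_word v <-> fim_cong (spell_word u) (spell_word v).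
Proof. by rewrite !eval_wordE; apply: fim_classP. Qed.

Lemma spell_word_inv w : spell_word (inv_word w) = inv_word (spell_word w).
Proof.
elim: w => // a w IH; rewrite inv_word_cons /spell_word /= inv_word_cat -IH.
rewrite map_rcons flatten_rcons; congr (_ ++ _).
by rewrite /spell /inv_letter /=; case: a.2; rewrite /= ?inv_wordK.
Qed.

End Spelling.

(** Rejecting a separator in the second phase and an end-marker in the first forces exactly one
    separator. *)
Definition decode1 A (ph : bool) (l : tape_symbol (option A)) :=
  match l with
  | Letter (Some a) => Some (Some a)
  | Letter None => if ph then None else Some None
  | EndMarker => if ph then Some None else None
  end.

(** The second tape stays untouched until the first, with its end-marker, has been read. *)
Definition decode2 A (ph : bool) (l : tape_symbol A + tape_symbol A) :=
  match l with
  | inl (Letter a) => if ph then None else Some (Some a)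
  | inl EndMarker => if ph then None else Some None
  | inr (Letter a) => if ph then Some (Some a) else None
  | inr EndMarker => if ph then Some None else None
  end.

Lemma consume1_None A (w w' : seq (tape_symbol A)) : consume1 None w w' <-> w' = w.
Proof.
split=> [|->]; last exact: Consume1Eps.
by move oE: None => o c; case: c oE.
Qed.

Lemma consume1_Some A a (w w' : seq (tape_symbol A)) :
  consume1 (Some a) w w' -> w = a :: w'.
Proof. by move oE: (Some a) => o c; case: c oE => // ? ? [->]. Qed.

Lemma consume2_None A (w w' : seq (tape_symbol A) * seq (tape_symbol A)) :
  consume2 None w w' <-> w' = w.
Proof.
split=> [|->]; last exact: Consume2Eps.
by move oE: None => o c; case: c oE.
Qed.

Lemma consume2_Some A l (w w' : seq (tape_symbol A) * seq (tape_symbol A)) :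
  consume2 (Some l) w w' ->
  w = match l with inl a => (a :: w'.1, w'.2) | inr a => (w'.1, a :: w'.2) end.
Proof. by move oE: (Some l) => o c; case: c oE => // ? ? ? [->]. Qed.

Lemma reads1P A ph (w : seq (tape_symbol (option A))) us w' :
  reads (@decode1 A) (@consume1 _) ph w us w' <->
  w = map (@Letter _) (map Some us) ++ (if ph then EndMarker else Letter None) :: w'.
Proof.
split=> [rd | ->].
  elim: rd => {w us w'} [l w w' + /consume1_Some-> |
                         l a w w' us w'' + /consume1_Some-> _ ->].
    by case: l ph => [[x|]|] [].
  by case: l ph => [[x|]|] [] //= [->].
elim: us => [|a us IH].
  by apply: ReadsEnd (Consume1Read _ _); case: ph.
exact: ReadsLetter (Consume1Read _ _) IH.
Qed.

Lemma reads2P A ph (w : seq (tape_symbol A) * seq (tape_symbol A)) us w' :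
  reads (@decode2 A) (@consume2 _) ph w us w' <->
  w = if ph then (w'.1, map (@Letter _) us ++ EndMarker :: w'.2)
      else (map (@Letter _) us ++ EndMarker :: w'.1, w'.2).
Proof.
split=> [rd | ->].
  elim: rd => {w us w'} [l w w' + /consume2_Some-> |
                         l a w w' us w'' + /consume2_Some-> _ ->].
    by case: l ph => [[x|]|[x|]] [].
  by case: l ph => [[x|]|[x|]] [] //= [->].
case: w' => w1 w2; case: ph => /=; elim: us => [|a us IH].
- exact: ReadsEnd (Consume2Snd _ _ _).
- exact: ReadsLetter (Consume2Snd _ _ _) IH.
- exact: ReadsEnd (Consume2Fst _ _ _).
- exact: ReadsLetter (Consume2Fst _ _ _) IH.
Qed.

Lemma tape_inj A : injective (@tape A).
Proof. by move=> u v /rcons_inj[]; apply: inj_map => a b []. Qed.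

Theorem theorem4 (X : {fset FIM_ 1}) :
  generates X ->
  csa_recognised (word_problem X) /\ csa2_recognised (two_tape_word_problem X).
Proof.
move=> _; split.
  (* The second word is an inverse, so its walk leads back from target to origin. *)
  exists (machine (@spell X) (max_spell X) (@decode1 _) true) => w.
  apply: iff_trans (iff_sym (machineP (@size_spell X) _ _ (@consume1_None _) _ _)).
  split=> [[u [v [/eval_word_eq/fim_cong_walksP[n [i [j [wu wv]]]] ->]]] |].
    exists n, i, j, u, (inv_word v),
      (map (@Letter _) (map Some (inv_word v)) ++ [:: EndMarker]).
    split=> //; last by rewrite -/(spell_word _) spell_word_inv inv_wordK.
      by apply/reads1P; rewrite /tape map_cat -cats1 -catA.
    exact/reads1P.
  case=> n [i [j [us [vs [w1 [/reads1P wE /reads1P w1E wu wv]]]]]].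
  exists us, (inv_word vs); split.
    by apply/eval_word_eq/fim_cong_walksP; exists n, i, j; rewrite spell_word_inv.
  apply: tape_inj; rewrite wE w1E inv_wordK.
  by rewrite /tape map_cat -cats1 -catA.
exists (machine (@spell X) (max_spell X) (@decode2 _) false) => u v.
apply: iff_trans (iff_sym (machineP (@size_spell X) _ _ (@consume2_None _) _ _)).
split=> [/eval_word_eq/fim_cong_walksP[n [i [j [wu wv]]]] |].
  exists n, i, j, u, v, ([::], tape v).
  by split=> //; apply/reads2P; rewrite /tape -cats1.
case=> n [i [j [us [vs [w1 [/reads2P + /reads2P w1E wu wv]]]]]].
rewrite w1E /= !cats1 -!/(tape _) => -[/tape_inj-> /tape_inj->].
by apply/eval_word_eq/fim_cong_walksP; exists n, i, j.
Qed.
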